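(* Let $A\in M_n(\mathfrak{W}_{\mathbb{Q}})$. If $\det A(x)\neq0$ for every $x\in S^1_{\mathbb{Q}}$, then $A^{-1}\in M_n(\mathfrak{W}_{\mathbb{Q}})$. Equivalently, pointwise invertibility on $S^1_{\mathbb{Q}}$ is the same as invertibility in the rational Wiener matrix algebra $M_n(\mathfrak{W}_{\mathbb{Q}})$.
   Context: The universal solenoid is $S^1_{\mathbb{Q}}=\varprojlim S^1$ over positive integers ordered by divisibility, with bonding maps $z\mapsto z^{m/n}$ for $n\mid m$; it is a compact connected abelian group with Pontryagin dual the discrete group $\mathbb{Q}$. For $q=k/N\in\mathbb{Q}$ the corresponding character is $\chi_q(\mathbf{u})=\pi_N(\mathbf{u})^k$, where $\pi_N:S^1_{\mathbb{Q}}\to S^1$ is the projection to level $N$. The rational Wiener algebra $\mathfrak{W}_{\mathbb{Q}}$ is the Banach algebra of functions $f=\sum_{q\in\mathbb{Q}}a_q\chi_q:S^1_{\mathbb{Q}}\to\mathbb{C}$ with $\|f\|=\sum_{q\in\mathbb{Q}}|a_q|<\infty$, under pointwise multiplication. $M_n(\mathfrak{W}_{\mathbb{Q}})$ is the algebra of $n\times n$ matrices with entries in $\mathfrak{W}_{\mathbb{Q}}$, and $A^{-1}$ denotes the pointwise inverse. *)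

(* Defs.v *)
From HB Require Import structures.
From mathcomp Require Import all_boot all_order all_algebra finmap.
From mathcomp Require Import complex.
From mathcomp Require Import all_classical all_reals ereal topology normedtype.
From mathcomp Require Import esum.
From mathcomp.analysis.showcase Require Import summability.
From mathcomp Require Import lra ring.
Set Implicit Arguments.
Unset Strict Implicit.
Unset Printing Implicit Defensive.
Import Order.TTheory GRing.Theory Num.Theory.
Import numFieldNormedType.Exports.
Local Open Scope classical_set_scope.
Local Open Scope ring_scope.

#[export] Existing Instance totally_filter.

Local Notation normc := ComplexField.Normc.normc.

(* Unordered summation: convergence of the finite partial sums along the filter
   [totally] of finite index sets directed by inclusion. R[i]^o carries the
   topology of the complex modulus. *)
Definition has_sum (R : realType) (I : choiceType) (x : I -> R[i]) (s : R[i]) :=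
  (fun F : {fset I} => \sum_(i <- F) x i : R[i]^o) @ totally --> (s : R[i]^o).

Definition abs_summable (R : realType) (I : choiceType) (x : I -> R[i]) :=
  (\esum_(i in [set: I]) (normc (x i))%:E < +oo)%E.

Lemma big_fsetM (V : nmodType) (I J : choiceType) (A : {fset I}) (B : {fset J})
    (f : I * J -> V) :
  \sum_(k <- (A `*` B)%fset) f k = \sum_(i <- A) \sum_(j <- B) f (i, j).
Proof.
rewrite -big_allpairs; apply: perm_big; apply: uniq_perm.
- exact: fset_uniq.
- by apply: allpairs_uniq; [exact: fset_uniq|exact: fset_uniq|case=> ? ? [? ?]].
- move=> [i j]; rewrite in_fsetM/=; apply/andP/allpairsP => [[iA jB]|].
    by exists (i, j).
  by case=> -[i' j'] [? ? [-> ->]].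
Qed.

Section HasSum.
Context {R : realType}.

Lemma norm_normc (z : R[i]) : `|z| = (normc z)%:C%C.
Proof. by []. Qed.

Lemma normc_ge0 (z : R[i]) : 0 <= normc z.
Proof. by case: z => a b /=; exact: sqrtr_ge0. Qed.

Lemma has_sumP (I : choiceType) (x : I -> R[i]) s : has_sum x s <->
  forall e : R, 0 < e -> exists F0 : {fset I}, forall F : {fset I},
    (F0 `<=` F)%fset -> normc (s - \sum_(i <- F) x i) < e.
Proof.
split => [h e e0|h].
- have e0' : 0 < e%:C%C :> R[i] by rewrite ltcR.
  have /cvgrPdist_lt/(_ _ e0') [A _ hA] := h.
  by exists A => F /hA /=; rewrite norm_normc ltcR.
- apply/cvgrPdist_lt => -[e ei] /[dup] e0; rewrite ltcE /= => /andP[/eqP ei0 e1].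
  have [A hA] := h _ e1; exists A => // F /= /hA; rewrite norm_normc.
  by rewrite -ltcR ei0.
Qed.

Lemma has_sum_unique (I : choiceType) (x : I -> R[i]) s t :
  has_sum x s -> has_sum x t -> s = t.
Proof.
move=> /has_sumP hs /has_sumP ht; apply/eqP; rewrite -subr_eq0; apply/eqP.
apply: ComplexField.Normc.eq0_normc; apply/eqP; rewrite eq_le normc_ge0 andbT.
apply/ler_addgt0Pr => e e0; rewrite add0r.
have [A hA] := hs (e / 2) ltac:(by lra).
have [B hB] := ht (e / 2) ltac:(by lra).
have := hA (A `|` B)%fset (fsubsetUl _ _).
have := hB (A `|` B)%fset (fsubsetUr _ _).
set z := \sum_(i <- _) _ => h1 h2.
have -> : s - t = (s - z) + - (t - z) by rewrite opprB addrA subrK.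
by apply: (le_trans (le_normcD _ _)); rewrite normcN; lra.
Qed.

Lemma has_sumB (I : choiceType) (x y : I -> R[i]) s t :
  has_sum x s -> has_sum y t -> has_sum (fun i => x i - y i) (s - t).
Proof.
move=> hs ht; rewrite /has_sum; under eq_fun do rewrite sumrB.
exact: cvgB hs ht.
Qed.

Lemma has_sumD (I : choiceType) (x y : I -> R[i]) s t :
  has_sum x s -> has_sum y t -> has_sum (fun i => x i + y i) (s + t).
Proof.
move=> hs ht; rewrite /has_sum; under eq_fun do rewrite (@big_split R[i])/=.
exact: cvgD hs ht.
Qed.

Lemma has_sum0 (I : choiceType) : has_sum (fun _ : I => 0 : R[i]) 0.
Proof.
rewrite /has_sum; under eq_fun do rewrite big1_eq.
exact: (@cvg_cst R[i]^o).
Qed.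

Lemma has_sumZ (I : choiceType) (x : I -> R[i]) s c :
  has_sum x s -> has_sum (fun i => c * x i) (c * s).
Proof.
move=> hs; rewrite /has_sum; under eq_fun do rewrite -mulr_sumr.
exact: cvgMr hs.
Qed.

Lemma has_sum1 (I : choiceType) (x : I -> R[i]) i0 :
  (forall i, i != i0 -> x i = 0) -> has_sum x (x i0).
Proof.
move=> h; apply/has_sumP => e e0; exists [fset i0]%fset => F.
rewrite fsub1set => iF; rewrite (big_fsetD1 i0)//= big_seq big1 ?addr0 ?subrr.
  by rewrite ComplexField.Normc.normc0.
by move=> i; rewrite !inE => /andP[/h].
Qed.

Lemma has_sum_reindex (I J : choiceType) (e : I -> J) (e' : J -> I)
    (x : J -> R[i]) s : cancel e e' -> cancel e' e ->
  has_sum x s -> has_sum (x \o e) s.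
Proof.
move=> ee' e'e /has_sumP h; apply/has_sumP => d /h[A hA].
exists [fset e' j | j in A]%fset => F AF.
have := hA [fset e i | i in F]%fset; rewrite big_imfset/=; last first.
  by move=> i j _ _ /(can_inj ee').
apply; apply/fsubsetP => j jA; apply/imfsetP; exists (e' j); rewrite ?e'e//.
by apply: (fsubsetP AF); apply/imfsetP; exists j.
Qed.

Lemma has_sum_sum (I J : choiceType) (r : seq I) (x : I -> J -> R[i]) y :
  (forall i, has_sum (x i) (y i)) ->
  has_sum (fun j => \sum_(i <- r) x i j) (\sum_(i <- r) y i).
Proof.
move=> h; elim: r => [|i r IH].
  rewrite big_nil (_ : (fun j => _) = (fun=> 0)); first exact: has_sum0.
  by apply/funext => j; rewrite big_nil.
rewrite big_cons (_ : (fun j => _) = (fun j => x i j + \sum_(i <- r) x i j)).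
  exact: has_sumD.
by apply/funext => j; rewrite big_cons.
Qed.

Lemma has_sum_fibre (I J : choiceType) (x : I * J -> R[i]) s y :
  has_sum x s -> (forall i, has_sum (fun j => x (i, j)) (y i)) -> has_sum y s.
Proof.
move=> /has_sumP hs hy; apply/has_sumP => e e0.
have [K hK] := hs (e / 2) ltac:(by lra).
exists [fset k.1 | k in K]%fset => F KF.
have /has_sumP/(_ (e / 2) ltac:(by lra))[G hG] := @has_sum_sum _ _ F (fun i j => x (i, j)) y hy.
have := hG (G `|` [fset k.2 | k in K])%fset (fsubsetUl _ _).
set G' := (_ `|` _)%fset.
have := hK (F `*` G')%fset.
rewrite big_fsetM exchange_big/=.
set T1 := \sum_(i <- F) y i; set T2 := \sum_(j <- _) _.
move=> h1 h2.
have {}h1 : normc (s - T2) < e / 2.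
  apply: h1; apply/fsubsetP => k kK; rewrite inE; apply/andP; split.
    by apply: (fsubsetP KF); apply/imfsetP; exists k.
  by rewrite inE; apply/orP; right; apply/imfsetP; exists k.
have -> : s - T1 = (s - T2) + - (T1 - T2) by rewrite opprB addrA subrK.
by apply: (le_lt_trans (le_normcD _ _)); rewrite normcN; lra.
Qed.

Lemma abs_summableP (I : choiceType) (x : I -> R[i]) : abs_summable x <->
  exists M : R, forall F : {fset I}, \sum_(i <- F) normc (x i) <= M.
Proof.
split.
- rewrite /abs_summable; set S := esum _ _ => Soo.
  have S0 : (0 <= S)%E by apply: esum_ge0 => i _; rewrite lee_fin normc_ge0.
  exists (fine S) => F; rewrite -lee_fin fineK ?ge0_fin_numE// -sumEFin.
  apply: esum_ge; exists [set` F] => //.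
  by rewrite fsbig_finite//= set_fsetK.
- case=> M hM; apply: (@le_lt_trans _ _ M%:E); last by rewrite ltry.
  apply: ge_ereal_sup => _ [X [finX _] <-].
  by rewrite fsbig_finite//= sumEFin lee_fin hM.
Qed.

Lemma ler_sum_fset (I : choiceType) (x : I -> R) (A B : {fset I}) :
  (forall i, 0 <= x i) -> (A `<=` B)%fset ->
  \sum_(i <- A) x i <= \sum_(i <- B) x i.
Proof.
move=> x0 AB; rewrite (big_fsetID _ (mem A) B)/= [leRHS]addrC.
have -> : [fset i in B | i \in A]%fset = A.
  by apply/fsetP => i; rewrite !inE andb_idl// => /(fsubsetP AB).
by rewrite lerDr sumr_ge0.
Qed.

Lemma real_sum_ex0 (I : choiceType) (x : I -> R) M :
  (forall i, 0 <= x i) ->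
  (forall F : {fset I}, \sum_(i <- F) x i <= M) ->
  exists s, forall e : R, 0 < e -> exists F0 : {fset I}, forall F : {fset I},
    (F0 `<=` F)%fset -> `|s - \sum_(i <- F) x i| < e.
Proof.
move=> x0 hM; pose S := [set \sum_(i <- F) x i | F in [set: {fset I}]].
have hS : has_sup S.
  split; first by exists (\sum_(i <- fset0) x i); exists fset0.
  by exists M => _ [F _ <-].
exists (sup S) => e e0; have [_ [F0 _ <-] h] := sup_adherent e0 hS.
exists F0 => F F0F.
have h1 := ler_sum_fset x0 F0F.
have h2 : \sum_(i <- F) x i <= sup S by apply: ub_le_sup; [case: hS|exists F].
by rewrite ger0_norm; lra.
Qed.

Lemma real_sum_ex (I : choiceType) (x : I -> R) M :
  (forall F : {fset I}, \sum_(i <- F) `|x i| <= M) ->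
  exists s, forall e : R, 0 < e -> exists F0 : {fset I}, forall F : {fset I},
    (F0 `<=` F)%fset -> `|s - \sum_(i <- F) x i| < e.
Proof.
move=> hM.
have [s hs] := real_sum_ex0 (fun i => normr_ge0 (x i)) hM.
have [||t ht] := @real_sum_ex0 _ (fun i => `|x i| + x i) (M + M).
- by move=> i; have := ler_norm (- x i); rewrite normrN; lra.
- move=> F; apply: (@le_trans _ _ (\sum_(i <- F) (`|x i| + `|x i|))).
    by apply: ler_sum => i _; rewrite lerD2l ler_norm.
  by rewrite big_split/=; have := hM F; lra.
exists (t - s) => e e0.
have [A hA] := hs (e / 2) ltac:(by lra).
have [B hB] := ht (e / 2) ltac:(by lra).
exists (A `|` B)%fset => F; rewrite fsubUset => /andP[/hA + /hB].
rewrite big_split/=; set u := \sum_(i <- F) `|_|; set v := \sum_(i <- F) _.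
move=> h1 h2.
have -> : t - s - v = (t - (u + v)) - (s - u) by ring.
by apply: (le_lt_trans (ler_normB _ _)); lra.
Qed.

Lemma normc_le (z : R[i]) :
  [/\ `|complex.Re z| <= normc z, `|complex.Im z| <= normc z
    & normc z <= `|complex.Re z| + `|complex.Im z|].
Proof.
case: z => a b /=; split.
- by rewrite -sqrtr_sqr ler_sqrt ?lerDl ?sqr_ge0// addr_ge0 ?sqr_ge0.
- by rewrite -sqrtr_sqr ler_sqrt ?lerDr ?sqr_ge0// addr_ge0 ?sqr_ge0.
- rewrite -[leRHS]ger0_norm ?addr_ge0// -sqrtr_sqr ler_sqrt ?sqr_ge0//.
  rewrite sqrrD !real_normK ?num_real//.
  have := mulr_ge0 (normr_ge0 a) (normr_ge0 b).
  by rewrite -mulr_natr; nra.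
Qed.

Lemma has_sum_ex (I : choiceType) (x : I -> R[i]) :
  abs_summable x -> exists s, has_sum x s.
Proof.
move=> /abs_summableP[M hM].
have [|a ha] := @real_sum_ex _ (fun i => complex.Re (x i)) M.
  move=> F; apply: le_trans (hM F); apply: ler_sum => i _.
  by case: (normc_le (x i)).
have [|b hb] := @real_sum_ex _ (fun i => complex.Im (x i)) M.
  move=> F; apply: le_trans (hM F); apply: ler_sum => i _.
  by case: (normc_le (x i)).
exists (Complex a b); apply/has_sumP => e e0.
have [A hA] := ha (e / 2) ltac:(by lra).
have [B hB] := hb (e / 2) ltac:(by lra).
exists (A `|` B)%fset => F; rewrite fsubUset => /andP[/hA h1 /hB h2].
set z := Complex a b - _.
have hr : complex.Re z = a - \sum_(i <- F) complex.Re (x i).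
  rewrite /z (_ : \sum_(i <- F) x i =
    Complex (\sum_(i <- F) complex.Re (x i)) (\sum_(i <- F) complex.Im (x i)))//.
  elim/big_rec3: _ => [//|i u v w _ ->]; by case: (x i).
have hi : complex.Im z = b - \sum_(i <- F) complex.Im (x i).
  rewrite /z (_ : \sum_(i <- F) x i =
    Complex (\sum_(i <- F) complex.Re (x i)) (\sum_(i <- F) complex.Im (x i)))//.
  elim/big_rec3: _ => [//|i u v w _ ->]; by case: (x i).
by case: (normc_le z) => _ _; rewrite hr hi; lra.
Qed.

Lemma has_sum_norm_le (I : choiceType) (x : I -> R[i]) s : has_sum x s ->
  ((normc s)%:E <= \esum_(i in [set: I]) (normc (x i))%:E)%E.
Proof.
move=> /has_sumP h; apply/lee_addgt0Pr => e e0.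
have [A /(_ A (fsubset_refl _)) hA] := h _ e0.
apply: (@le_trans _ _ ((\sum_(i <- A) normc (x i))%:E + e%:E)%E).
  rewrite -EFinD lee_fin -[s](subrK (\sum_(i <- A) x i)).
  apply: (le_trans (le_normcD _ _)); rewrite addrC lerD//; last exact: ltW.
  elim/big_rec2: _ => [|i u v _ uv]; first by rewrite ComplexField.Normc.normc0.
  by apply: (le_trans (le_normcD _ _)); rewrite lerD2l.
rewrite leeD2r// -sumEFin; apply: esum_ge; exists [set` A] => //.
by rewrite fsbig_finite//= set_fsetK.
Qed.

Lemma abs_summable_prod (I J : choiceType) (x : I -> R[i]) (y : J -> R[i]) :
  abs_summable x -> abs_summable y ->
  abs_summable (fun k : I * J => x k.1 * y k.2).
Proof.
move=> /abs_summableP[M hM] /abs_summableP[N hN]; apply/abs_summableP.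
exists (M * N) => F.
pose A := [fset k.1 | k in F]%fset; pose B := [fset k.2 | k in F]%fset.
apply: (@le_trans _ _ (\sum_(k <- (A `*` B)%fset) normc (x k.1 * y k.2))).
  apply: ler_sum_fset => [i|]; first exact: normc_ge0.
  by apply/fsubsetP => k kF; rewrite inE; apply/andP; split;
     apply/imfsetP; exists k.
rewrite big_fsetM/=.
under eq_bigr do under eq_bigr do rewrite ComplexField.Normc.normcM.
under eq_bigr do rewrite -mulr_sumr.
rewrite -mulr_suml ler_pM// ?sumr_ge0// => i _; exact: normc_ge0.
Qed.

Lemma abs_summableB (I : choiceType) (x y : I -> R[i]) :
  abs_summable x -> abs_summable y -> abs_summable (fun i => x i - y i).
Proof.
move=> /abs_summableP[M hM] /abs_summableP[N hN]; apply/abs_summableP.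
exists (M + N) => F; apply: le_trans (lerD (hM F) (hN F)).
rewrite -big_split/=; apply: ler_sum => i _.
by apply: (le_trans (le_normcD _ _)); rewrite normcN.
Qed.

Lemma abs_summable_reindex (I J : choiceType) (e : I -> J) (x : J -> R[i]) :
  injective e -> abs_summable x -> abs_summable (x \o e).
Proof.
move=> ei /abs_summableP[M hM]; apply/abs_summableP; exists M => F.
have := hM [fset e i | i in F]%fset.
by rewrite big_imfset//= => i j _ _; exact: ei.
Qed.

Lemma abs_summable_fibre (I J : choiceType) (x : I * J -> R[i]) y :
  abs_summable x -> (forall i, has_sum (fun j => x (i, j)) (y i)) ->
  abs_summable y.
Proof.
move=> hx hy; apply: (le_lt_trans _ hx).
have := @esum_esum R I J setT (fun=> setT) (fun i j => (normc (x (i, j)))%:E).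
move=> /(_ _)/= h.
have -> : (\esum_(i in [set: I * J]) (normc (x i))%:E =
   \esum_(k in [set: I] `*`` (fun=> [set: J])) (normc (x (k.1, k.2)))%:E)%E.
  have -> : [set: I] `*`` (fun=> [set: J]) = [set: I * J].
    by apply/seteqP; split => // -[].
  by apply: eq_esum => -[].
rewrite -h; last by move=> *; rewrite lee_fin normc_ge0.
by apply: le_esum => i _; apply: has_sum_norm_le.
Qed.

Lemma abs_summable_fibre1 (I J : choiceType) (x : I * J -> R[i]) i :
  abs_summable x -> abs_summable (fun j => x (i, j)).
Proof. by apply: abs_summable_reindex => j k []. Qed.

End HasSum.
Arguments has_sumZ {R I x s} c _.

Definition posnat := {N : nat | (0 < N)%N}.

Section Solenoid.
Context {R : realType}.

(* An element of the inverse limit is a compatible thread; the bonding map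
   from level m to level n, for n %| m, is z |-> z ^+ (m %/ n). *)
Record solenoid := Solenoid {
  proj : posnat -> R[i];
  proj_circle : forall N, `|proj N| = 1;
  proj_compat : forall m n : posnat, (val n %| val m)%N ->
    proj m ^+ (val m %/ val n) = proj n }.

HB.instance Definition _ := gen_eqMixin solenoid.
HB.instance Definition _ := gen_choiceMixin solenoid.

Definition solenoid1 : solenoid :=
  @Solenoid (fun=> 1) (fun=> normr1 _) (fun _ _ _ => expr1n _ _).

HB.instance Definition _ := isPointed.Build solenoid solenoid1.

Lemma denq_pos_subproof (q : rat) : (0 < `|denq q|)%N.
Proof. by rewrite absz_gt0 denq_neq0. Qed.

Definition denq_pos (q : rat) : posnat := exist _ `|denq q|%N (denq_pos_subproof q).

(* The character is defined from the reduced fraction of q; chi_frac shows that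
   any other representation k / N gives the same value. *)
Definition chi (q : rat) (u : solenoid) : R[i] := proj u (denq_pos q) ^ numq q.

Lemma proj_neq0 u N : proj u N != 0.
Proof. by rewrite -normr_eq0 proj_circle oner_neq0. Qed.

Lemma chi_frac (k : int) (N : posnat) u :
  chi (k%:~R / (val N)%:R) u = proj u N ^ k.
Proof.
set q : rat := _ / _; have N0 : (0 < val N)%N := valP N.
have NQ : (val N)%:R != 0 :> rat by rewrite pnatr_eq0 -lt0n.
have hZ : numq q * (val N)%:Z = k * denq q.
  apply: (@intr_inj rat); rewrite !rmorphM/= numqE.
  by rewrite mulrAC /q -[(val N)%:~R]pmulrn divfK.
have dN : (`|denq q| %| val N)%N.
  rewrite -(@Gauss_dvdr _ `|numq q|%N); last first.
    by rewrite coprime_sym coprime_num_den.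
  rewrite -[X in (_ * X)%N]absz_nat -abszM hZ abszM; exact: dvdn_mull.
rewrite /chi -(@proj_compat u N (denq_pos q) dN) /= exprnP exprz_exp.
congr (_ ^ _); have d0 : denq q != 0 by rewrite denq_neq0.
apply: (mulIf d0); rewrite -hZ mulrAC mulrC; congr (_ * _).
by rewrite -{2}[denq q]absz_denq -PoszM divnK.
Qed.

Lemma norm_chi q u : `|chi q u| = 1.
Proof. rewrite /chi; case: (numq q) => n; first by rewrite -exprnP normrX proj_circle expr1n.
by rewrite NegzE -exprnN normfV normrX proj_circle expr1n invr1. Qed.

Lemma chi0 u : chi 0 u = 1.
Proof. by rewrite /chi (_ : numq 0 = 0) ?expr0z. Qed.

Lemma chiD p q u : chi (p + q) u = chi p u * chi q u.
Proof.
have MN0 : (0 < `|denq p| * `|denq q|)%N by rewrite muln_gt0 !denq_pos_subproof.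
pose N : posnat := Sub _ MN0.
have hd (r : rat) : (denq r)%:~R != 0 :> rat by rewrite intr_eq0 denq_neq0.
have vN : (val N)%:R = (denq p)%:~R * (denq q)%:~R :> rat.
  by rewrite /= pmulrn PoszM !absz_denq rmorphM.
have hp : p = (numq p * denq q)%:~R / (val N)%:R.
  rewrite vN rmorphM/= -{1}[p]divq_num_den; field; by rewrite !hd.
have hq : q = (numq q * denq p)%:~R / (val N)%:R.
  rewrite vN rmorphM/= -{1}[q]divq_num_den; field; by rewrite !hd.
have -> : p + q = (numq p * denq q + numq q * denq p)%:~R / (val N)%:R.
  by rewrite rmorphD/= mulrDl -hp -hq.
by rewrite chi_frac expfzDr ?proj_neq0// -!chi_frac -hp -hq.
Qed.

End Solenoid.
Arguments solenoid : clear implicits.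

Section Wiener.
Context {R : realType}.
Implicit Types (f g : solenoid R -> R[i]) (a b : rat -> R[i]).

(* f = \sum_q a_q chi_q with \sum_q |a_q| < +oo. As |chi_q| = 1 pointwise, the
   series then also converges to f uniformly. *)
Definition wiener_expansion a f :=
  abs_summable a /\ forall u, has_sum (fun q => a q * chi q u) (f u).

Definition wiener : {pred (solenoid R -> R[i])} :=
  [pred f | `[< exists a, wiener_expansion a f >]].

Lemma wienerP f : reflect (exists a, wiener_expansion a f) (f \in wiener).
Proof. exact: asboolP. Qed.

Lemma normc_chi q (u : solenoid R) : normc (chi q u) = 1.
Proof. by apply: complexI; rewrite -norm_normc norm_chi. Qed.

Lemma abs_summable_chi a u :
  abs_summable a -> abs_summable (fun q => a q * chi q u).
Proof.
rewrite /abs_summable; congr (_ < _)%E; apply: eq_esum => q _.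
by rewrite ComplexField.Normc.normcM normc_chi mulr1.
Qed.

Lemma wiener_subring : subring_closed wiener.
Proof.
split.
- apply/wienerP; exists (fun q => (q == 0)%:R); split.
    apply/abs_summableP; exists 1 => F.
    case: (boolP (0 \in F)) => F0.
      rewrite (big_fsetD1 0 F0) eqxx ComplexField.Normc.normc1 big_seq.
      rewrite big1 ?Monoid.mulm1// => i; rewrite !inE => /andP[/negPf-> _].
      by rewrite ComplexField.Normc.normc0.
    rewrite big_seq big1 ?ler01// => i iF; case: eqP => [i0|].
      by rewrite -i0 iF in F0.
    by rewrite ComplexField.Normc.normc0.
  move=> u; have := @has_sum1 R rat (fun q => (q == 0)%:R * chi q u) 0.
  rewrite eqxx mul1r chi0; apply => q /negPf->; exact: mul0r.
- move=> f g /wienerP[a [ha hf]] /wienerP[b [hb hg]]; apply/wienerP.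
  exists (fun q => a q - b q); split; first exact: abs_summableB.
  move=> u; have := has_sumB (hf u) (hg u).
  by congr has_sum; apply/funext => q; rewrite mulrBl.
- move=> f g /wienerP[a [ha hf]] /wienerP[b [hb hg]]; apply/wienerP.
  pose e (k : rat * rat) := (k.1 - k.2, k.2).
  pose e' (k : rat * rat) := (k.1 + k.2, k.2).
  have ee' : cancel e e' by case=> p q; rewrite /e/e'/= subrK.
  have e'e : cancel e' e by case=> p q; rewrite /e/e'/= addrK.
  pose z : rat * rat -> R[i] := (fun k => a k.1 * b k.2) \o e.
  have hz : abs_summable z.
    apply: abs_summable_reindex; first exact: can_inj ee'.
    exact: abs_summable_prod.
  have /choice[c hc] : forall r, exists s, has_sum (fun q => z (r, q)) s.
    by move=> r; apply: has_sum_ex; apply: abs_summable_fibre1.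
  exists c; split; first exact: abs_summable_fibre hz hc.
  move=> u.
  pose w (k : rat * rat) := (a k.1 * chi k.1 u) * (b k.2 * chi k.2 u).
  have hw : abs_summable w.
    exact: (abs_summable_prod (abs_summable_chi u ha) (abs_summable_chi u hb)).
  have [S hS] := has_sum_ex hw.
  have -> : (f * g) u = S.
    have h1 := has_sum_fibre hS
      (fun p => has_sumZ (a p * chi p u) (hg u)).
    have h2 : has_sum (fun p => a p * chi p u * g u) (f u * g u).
      have := has_sumZ (g u) (hf u); rewrite mulrC.
      by congr has_sum; apply/funext => p; rewrite mulrC.
    exact: has_sum_unique h2 h1.
  apply: has_sum_fibre (has_sum_reindex ee' e'e hS) _ => r.
  have := has_sumZ (chi r u) (hc r); rewrite mulrC.
  congr has_sum; apply/funext => q.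
  have -> : chi r u = chi (r - q) u * chi q u by rewrite -chiD subrK.
  rewrite /w /z /=; ring.
Qed.

HB.instance Definition _ :=
  GRing.isSubringClosed.Build (solenoid R -> R[i]) wiener wiener_subring.

Record wienerQ := WienerQ {
  wiener_fun :> solenoid R -> R[i];
  _ : wiener_fun \in wiener }.

HB.instance Definition _ := [isSub for wiener_fun].
HB.instance Definition _ := [Choice of wienerQ by <:].
(* The ring operations are those inherited from functions, hence pointwise. *)
HB.instance Definition _ := [SubChoice_isSubComNzRing of wienerQ by <:].

Definition mxeval n (A : 'M[wienerQ]_n) (u : solenoid R) : 'M[R[i]]_n :=
  \matrix_(i, j) A i j u.

End Wiener.
Arguments wienerQ : clear implicits.

(* Main.v *)
Require Import Defs.
From HB Require Import structures.
From mathcomp Require Import all_boot all_order all_algebra finmap.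
From mathcomp Require Import cyclic separable cyclotomic complex.
From mathcomp Require Import all_classical all_reals ereal topology normedtype.
From mathcomp Require Import sequences esum.
From mathcomp Require Import lra ring.
Set Implicit Arguments.
Unset Strict Implicit.
Unset Printing Implicit Defensive.
Import Order.TTheory GRing.Theory Num.Theory.
Import numFieldNormedType.Exports.
Local Open Scope ring_scope.

(** Everything reduces to Wiener's lemma for the solenoid: an element f of the
    rational Wiener algebra W without zeros is a unit of W. Evaluation at a
    point is a ring morphism, so applying this to f = det A makes det A a unit,
    and the adjugate formula inverts A over W; evaluating that inverse gives
    the pointwise inverse.

    Wiener's lemma [wiener_lemma] is proved by Gelfand's method. If f is not a
    unit, it lies in a maximal ideal I ([exists_maximal_ideal]), and it is
    enough to find a point u of the solenoid at which all of I vanishes. For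
    each character chi_q there is a complex number L q with chi_q - L q in I;
    then L is a homomorphism from the rationals to the circle, which is the
    same thing as a compatible thread, that is, a point u with
    chi_q(u) = L q. Trigonometric polynomials P satisfy P - P(u) in I, and
    since they are dense and the elements at distance less than 1 from the
    constant 1 are units ([wnorm_le_neumann]), f(u) cannot differ from 0. Thus
    maximal ideals supply the points of the solenoid.

    The analytic core is the existence of L q ([exists_spectral_value]), the
    part of the Gelfand-Mazur theorem that concerns an element x with
    |x| <= 1 and |1/x| <= 1. If x - l were invertible modulo I for every
    complex l, the resolvent F(l) = 1/(1 - l x) would exist modulo I for all l,
    and by compactness of a square of the plane it would be bounded near the
    unit circle, hence Lipschitz there. Averaging F over the M-th roots of unity
    times r gives 1/(1 - (r x)^M) modulo I, which for large M is close to 1 if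
    r < 1 and close to 0 if r > 1. But the two averages differ by O(r' - r)
    uniformly in M, by the Lipschitz bound, so 1 would be at distance less than
    1 from I. This replaces the contour integrals of the usual proof by finite
    sums.

    The norm enters only through the relation [wnorm_le f c], saying that some
    expansion of f has coefficients of total mass at most c. The
    infimum of these c is the quotient norm of absolutely summable families. *)

Local Notation normc := ComplexField.Normc.normc.

(** * The complex modulus and geometric sequences *)

Section Normc.
Context {R : realType}.
Implicit Types z w : R[i].

Lemma normcM z w : normc (z * w) = normc z * normc w.
Proof. exact: ComplexField.Normc.normcM. Qed.

Lemma normcX z n : normc (z ^+ n) = normc z ^+ n.
Proof.
elim: n => [|n IH]; first by rewrite !expr0 ComplexField.Normc.normc1.
by rewrite !exprS normcM IH.
Qed.

Lemma normc_real (r : R) : 0 <= r -> normc r%:C%C = r.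
Proof. by move=> r0 /=; rewrite expr0n addr0 sqrtr_sqr ger0_norm. Qed.

Lemma normc_gt0 z : z != 0 -> 0 < normc z.
Proof.
move=> z0; rewrite lt_neqAle normc_ge0 andbT eq_sym.
by apply: contra_neq z0; exact: ComplexField.Normc.eq0_normc.
Qed.

Lemma normcV z : z != 0 -> normc z^-1 = (normc z)^-1.
Proof.
move=> z0; apply: (mulfI (lt0r_neq0 (normc_gt0 z0))).
rewrite -normcM (divff z0) divff ?ComplexField.Normc.normc1//.
by rewrite lt0r_neq0// normc_gt0.
Qed.

End Normc.

Lemma exprn_lt_eps (R : realType) (r e : R) : 0 <= r -> r < 1 -> 0 < e ->
  exists k0 : nat, forall k, (k0 <= k)%N -> r ^+ k < e.
Proof.
move=> r0 r1 e0.
have h : ((fun k : nat => r ^+ k) @ \oo --> (0 : R))%classic.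
  by apply: cvg_expr; rewrite ger0_norm.
have /cvgrPdist_lt/(_ _ e0)[k0 _ hk0] := h.
exists k0 => k /hk0; rewrite /= sub0r normrN ger0_norm// exprn_ge0//.
Qed.

(** * Families of bounded total mass *)

Lemma mem_fset_iota m n : (n \in [fset k in iota 0 m]%fset) = (n < m)%N.
Proof. by rewrite in_fset mem_iota. Qed.

Lemma big_fset_iota (V : nmodType) m (x : nat -> V) :
  \sum_(n <- [fset k in iota 0 m]%fset) x n = \sum_(n < m) x n.
Proof.
rewrite -(big_mkord xpredT) /index_iota subn0; apply: perm_big.
apply: uniq_perm; rewrite ?fset_uniq ?iota_uniq// => n.
by rewrite in_fset.
Qed.

Section Mass.
Context {R : realType}.

(** Quantitative form of absolute summability; stated with finite partial sums,
    which makes the closure properties elementary. *)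
Definition mass_le (I : choiceType) (x : I -> R[i]) (c : R) :=
  forall F : {fset I}, \sum_(i <- F) normc (x i) <= c.

Lemma mass_le_ge0 (I : choiceType) (x : I -> R[i]) c : mass_le x c -> 0 <= c.
Proof. by move=> /(_ fset0); rewrite big_seq_fset0. Qed.

Lemma mass_le_summable (I : choiceType) (x : I -> R[i]) c :
  mass_le x c -> abs_summable x.
Proof. by move=> h; apply/abs_summableP; exists c. Qed.

Lemma mass_le_esum (I : choiceType) (x : I -> R[i]) c :
  mass_le x c <-> (\esum_(i in [set: I]) (normc (x i))%:E <= c%:E)%E.
Proof.
split => [h|h F].
  apply: ge_ereal_sup => _ [X [finX _] <-].
  by rewrite fsbig_finite//= sumEFin lee_fin h.
rewrite -lee_fin -sumEFin; apply: le_trans h.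
apply: esum_ge; exists [set` F]%classic => //.
by rewrite fsbig_finite//= set_fsetK.
Qed.

Lemma has_sum_mass_le (I : choiceType) (x : I -> R[i]) c s :
  mass_le x c -> has_sum x s -> normc s <= c.
Proof.
move=> /mass_le_esum h /has_sum_norm_le hs.
by rewrite -lee_fin; exact: le_trans hs h.
Qed.

Lemma mass_le_fibre (I J : choiceType) (x : I * J -> R[i]) y c :
  mass_le x c -> (forall i, has_sum (fun j => x (i, j)) (y i)) ->
  mass_le y c.
Proof.
move=> /mass_le_esum hx hy; apply/mass_le_esum; apply: (le_trans _ hx).
have := @esum_esum R I J setT (fun=> setT) (fun i j => (normc (x (i, j)))%:E).
move=> /(_ _)/= h.
have -> : (\esum_(i in [set: I * J]) (normc (x i))%:E =
   \esum_(k in ([set: I] `*`` (fun=> [set: J]))%classic)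
     (normc (x (k.1, k.2)))%:E)%E.
  have -> : ([set: I] `*`` (fun=> [set: J]))%classic = [set: I * J]%classic.
    by apply/seteqP; split => // -[].
  by apply: eq_esum => -[].
rewrite -h; last by move=> *; rewrite lee_fin normc_ge0.
by apply: le_esum => i _; apply: has_sum_norm_le.
Qed.

Lemma mass_le_prod (I J : choiceType) (x : I -> R[i]) (y : J -> R[i]) c d :
  mass_le x c -> mass_le y d -> mass_le (fun k : I * J => x k.1 * y k.2) (c * d).
Proof.
move=> hc hd F.
pose A := [fset k.1 | k in F]%fset; pose B := [fset k.2 | k in F]%fset.
apply: (@le_trans _ _ (\sum_(k <- (A `*` B)%fset) normc (x k.1 * y k.2))).
  apply: ler_sum_fset => [i|]; first exact: normc_ge0.
  by apply/fsubsetP => k kF; rewrite inE; apply/andP; split;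
     apply/imfsetP; exists k.
rewrite big_fsetM/=.
under eq_bigr do under eq_bigr do rewrite normcM.
under eq_bigr do rewrite -mulr_sumr.
rewrite -mulr_suml ler_pM// ?sumr_ge0// => i _; exact: normc_ge0.
Qed.

Lemma mass_le_reindex (I J : choiceType) (e : I -> J) (x : J -> R[i]) c :
  injective e -> mass_le x c -> mass_le (x \o e) c.
Proof.
move=> ei h F; have := h [fset e i | i in F]%fset.
by rewrite big_imfset//= => i j _ _; exact: ei.
Qed.

(** The double family underlying a Neumann series: the n-th column carries the
    coefficients of the n-th power. *)
Lemma mass_le_geometric (I : choiceType) (x : I * nat -> R[i]) c :
  0 <= c -> c < 1 -> (forall n, mass_le (fun i => x (i, n)) (c ^+ n)) ->
  mass_le x (1 - c)^-1.
Proof.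
move=> c0 c1 h F.
pose A := [fset k.1 | k in F]%fset; pose m := (\max_(k <- F) k.2).+1.
pose B := [fset n in iota 0 m]%fset.
apply: (@le_trans _ _ (\sum_(k <- (A `*` B)%fset) normc (x k))).
  apply: ler_sum_fset => [i|]; first exact: normc_ge0.
  apply/fsubsetP => k kF; rewrite inE; apply/andP; split.
    by apply/imfsetP; exists k.
  rewrite /B mem_fset_iota ltnS.
  by rewrite (@leq_bigmax_seq _ (enum_fset F) xpredT (fun k => k.2) k).
rewrite big_fsetM exchange_big/=.
apply: (@le_trans _ _ (\sum_(n <- B) c ^+ n)).
  by apply: ler_sum => n _; exact: h.
rewrite big_fset_iota.
have <- : (1 - c)^-1 * (1 - c) * \sum_(n < m) c ^+ n = \sum_(n < m) c ^+ n.
  by rewrite mulVf ?mul1r// subr_eq0 gt_eqF.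
rewrite -mulrA ler_piMr// ?invr_ge0 ?subr_ge0; first exact: ltW.
have -> : (1 - c) * \sum_(n < m) c ^+ n = 1 - c ^+ m.
  by rewrite -[RHS]opprB subrX1 -mulNr opprB.
by rewrite lerBlDr lerDl exprn_ge0.
Qed.

(** The unordered sum exists by absolute summability. Its value is found by
    comparing it with the partial sums over initial segments, for which
    (1 - z) * (1 + ... + z^(k-1)) = 1 - z^k. *)
Lemma has_sum_geometric (z : R[i]) : normc z < 1 ->
  has_sum (fun n => z ^+ n) (1 - z)^-1.
Proof.
move=> z1.
have hm : abs_summable (fun n => z ^+ n).
  (* A one-row instance of the double family. *)
  have h1 : mass_le (fun k : unit * nat => z ^+ k.2) (1 - normc z)^-1.
    apply: mass_le_geometric; rewrite ?normc_ge0// => n F.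
    case: (boolP (tt \in F)) => F0.
      rewrite (big_fsetD1 tt F0)/= normcX big_seq big1 ?addr0// => -[].
      by rewrite !inE.
    rewrite big_seq big1 ?exprn_ge0 ?normc_ge0// => -[].
    by rewrite (negPf F0).
  apply: (@abs_summable_reindex _ _ _ (fun n => (tt, n))
    (fun k : unit * nat => z ^+ k.2)) => [m n []//|].
  exact: mass_le_summable h1.
have [s hs] := has_sum_ex hm; suff <- : s = (1 - z)^-1 by [].
have z1' : 1 - z != 0.
  rewrite subr_eq0; apply: contraTneq z1 => <-.
  by rewrite ComplexField.Normc.normc1 ltxx.
apply: (mulfI z1'); rewrite divff//; apply/eqP; rewrite -subr_eq0; apply/eqP.
apply: ComplexField.Normc.eq0_normc; apply/eqP; rewrite eq_le normc_ge0 andbT.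
apply/ler_addgt0Pr => e e0; rewrite add0r.
have e3 : 0 < e / 3 by lra.
have [F0 hF0] := (has_sumP _ _).1 hs (e / 3) e3.
have [k0 hk0] := exprn_lt_eps (normc_ge0 z) z1 e3.
pose k := maxn k0 (\max_(n <- F0) n).+1.
have := hF0 [fset n in iota 0 k]%fset.
rewrite big_fset_iota.
set t := \sum_(_ <- _) _ => ht.
have {}ht : normc (s - t) < e / 3.
  apply: ht; apply/fsubsetP => n nF; rewrite mem_fset_iota.
  rewrite leq_max; apply/orP; right; rewrite ltnS.
  by rewrite (@leq_bigmax_seq _ (enum_fset F0) xpredT id n).
have tE : (1 - z) * t = 1 - z ^+ k.
  by rewrite -[RHS]opprB subrX1 -mulNr opprB.
have -> : (1 - z) * s - 1 = (1 - z) * (s - t) + - z ^+ k.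
  by rewrite mulrBr tE; ring.
apply: (le_trans (le_normcD _ _)); rewrite normcN normcM normcX.
have := hk0 k (leq_maxl _ _); have := normc_ge0 (s - t).
have : normc (1 - z) <= 2.
  apply: (le_trans (le_normcD _ _)).
  by rewrite normcN ComplexField.Normc.normc1; lra.
by nra.
Qed.

(** F0 is a finite set whose mass is within e / 2 of the supremum. *)
Lemma mass_tail (I : choiceType) (x : I -> R[i]) c e : mass_le x c -> 0 < e ->
  exists F0 : {fset I}, mass_le (fun i => if i \in F0 then 0 else x i) e.
Proof.
move=> hx e0.
have [s hs] := real_sum_ex0 (fun i => normc_ge0 (x i)) hx.
have [F0 hF0] := hs (e / 2) ltac:(by lra); exists F0 => F.
have := hF0 F0 (fsubset_refl _); have := hF0 (F0 `|` F)%fset (fsubsetUl _ _).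
rewrite (big_fsetID _ (mem F0) (F0 `|` F)%fset) (big_fsetID _ (mem F0) F)/=.
have -> : [fset i in (F0 `|` F)%fset | i \in F0]%fset = F0.
  by apply/fsetP => i; rewrite !inE; case: (i \in F0); rewrite ?andbF.
have -> : [fset i in (F0 `|` F)%fset | i \notin F0]%fset =
          [fset i in F | i \notin F0]%fset.
  by apply/fsetP => i; rewrite !inE; case: (i \in F0); rewrite ?andbF.
rewrite [X in _ -> _ -> X + _ <= _]big_seq [X in _ -> _ -> X + _ <= _]big1; last first.
  by move=> i; rewrite !inE => /andP[_ ->]; rewrite ComplexField.Normc.normc0.
rewrite [X in _ -> _ -> _ + X <= _](eq_big_seq (fun i => normc (x i))); last first.
  by move=> i; rewrite !inE => /andP[_ /negPf->].
set a := \sum_(_ <- _) _; set b := \sum_(_ <- [fset _ | _ in _]%fset) _.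
by rewrite !ltr_distl add0r => /andP[h1 h2] /andP[h3 h4]; lra.
Qed.

End Mass.

(** * The norm of the rational Wiener algebra *)

Section WienerGauge.
Context {R : realType}.
Implicit Types f g : wienerQ R.

Lemma wienerQ_eq f g : (forall u, f u = g u) -> f = g.
Proof. by move=> h; apply: val_inj; apply/funext. Qed.

(** The norm of the Wiener algebra as a relation with the bound c. Since
    the expansion is quantified, the infimum of these c is the quotient norm
    inherited from absolutely summable families. *)
Definition wnorm_le f (c : R) :=
  exists2 a : rat -> R[i], mass_le a c &
    forall u, has_sum (fun q => a q * chi q u) (f u).

Lemma wnorm_le_ex f : exists c, wnorm_le f c.
Proof.
have /wienerP[a [/abs_summableP[c hc] ha]] := valP f.
by exists c, a.
Qed.

Lemma wnorm_le_ge0 f c : wnorm_le f c -> 0 <= c.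
Proof. by case=> a /mass_le_ge0. Qed.

Lemma wnorm_le_mono f c d : c <= d -> wnorm_le f c -> wnorm_le f d.
Proof. by move=> cd [a ha hf]; exists a => // F; exact: le_trans (ha F) cd. Qed.

Lemma mass_le_chi (a : rat -> R[i]) c (u : solenoid R) :
  mass_le a c -> mass_le (fun q => a q * chi q u) c.
Proof.
move=> h F; apply: le_trans (h F); rewrite le_eqVlt; apply/orP; left; apply/eqP.
by apply: eq_bigr => q _; rewrite normcM normc_chi mulr1.
Qed.

Lemma wnorm_le_normc f c u : wnorm_le f c -> normc (f u) <= c.
Proof.
by case=> a ha /(_ u); apply: has_sum_mass_le; exact: mass_le_chi.
Qed.

Lemma wnorm_leN f c : wnorm_le f c -> wnorm_le (- f) c.
Proof.
case=> a ha hf; exists (fun q => - a q) => [F|u].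
  by under eq_bigr do rewrite normcN; exact: ha.
have -> : (- f) u = -1 * f u by rewrite mulN1r.
have := has_sumZ (-1) (hf u); congr has_sum.
by apply/funext => q; rewrite mulN1r mulNr.
Qed.

Lemma wnorm_leD f g c d : wnorm_le f c -> wnorm_le g d -> wnorm_le (f + g) (c + d).
Proof.
case=> a ha hf [b hb hg]; exists (fun q => a q + b q) => [F|u].
  apply: le_trans (lerD (ha F) (hb F)).
  by rewrite -big_split/=; apply: ler_sum => i _; exact: le_normcD.
have := has_sumD (hf u) (hg u); congr has_sum.
by apply/funext => q; rewrite mulrDl.
Qed.

Lemma wnorm_leB f g c d : wnorm_le f c -> wnorm_le g d -> wnorm_le (f - g) (c + d).
Proof. by move=> hf /wnorm_leN; exact: wnorm_leD. Qed.

(** The coefficients of the product are the convolution of a and b: after the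
    shear (p, q) |-> (p + q, q) of the index set, the products a_p b_q are
    summed along the fibres p + q = r. *)
Lemma wnorm_leM f g c d : wnorm_le f c -> wnorm_le g d -> wnorm_le (f * g) (c * d).
Proof.
case=> a ha hf [b hb hg].
pose e (k : rat * rat) := (k.1 - k.2, k.2).
pose e' (k : rat * rat) := (k.1 + k.2, k.2).
have ee' : cancel e e' by case=> p q; rewrite /e /e' /= subrK.
have e'e : cancel e' e by case=> p q; rewrite /e /e' /= addrK.
pose z : rat * rat -> R[i] := (fun k => a k.1 * b k.2) \o e.
have hz : mass_le z (c * d).
  by apply: mass_le_reindex; [exact: can_inj ee'|exact: mass_le_prod].
have /choice[s hs] : forall r, exists s, has_sum (fun q => z (r, q)) s.
  move=> r; apply: has_sum_ex; apply: abs_summable_fibre1.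
  exact: mass_le_summable hz.
exists s; first exact: mass_le_fibre hz hs.
move=> u.
pose w (k : rat * rat) := (a k.1 * chi k.1 u) * (b k.2 * chi k.2 u).
have hw := mass_le_prod (mass_le_chi u ha) (mass_le_chi u hb).
have [S hS] := has_sum_ex (mass_le_summable hw).
have -> : (f * g) u = S.
  have h1 := has_sum_fibre hS (fun p => has_sumZ (a p * chi p u) (hg u)).
  have h2 : has_sum (fun p => a p * chi p u * g u) (f u * g u).
    have := has_sumZ (g u) (hf u); rewrite mulrC.
    by congr has_sum; apply/funext => p; rewrite mulrC.
  exact: has_sum_unique h2 h1.
apply: has_sum_fibre (has_sum_reindex ee' e'e hS) _ => r.
have := has_sumZ (chi r u) (hs r); rewrite mulrC.
congr has_sum; apply/funext => q.
have -> : chi r u = chi (r - q) u * chi q u by rewrite -chiD subrK.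
by rewrite /z /=; ring.
Qed.

Definition monomial_fun (c : R[i]) (p : rat) (u : solenoid R) := c * chi p u.

Lemma mass_le_single (c : R[i]) (p : rat) :
  mass_le (fun q => if q == p then c else 0) (normc c).
Proof.
move=> F; case: (boolP (p \in F)) => pF.
  rewrite (big_fsetD1 p pF) eqxx/= big_seq big1 ?addr0// => q.
  by rewrite !inE => /andP[/negPf-> _]; rewrite ComplexField.Normc.normc0.
rewrite big_seq big1 ?normc_ge0// => q; case: eqP => [->|_ _].
  by rewrite (negPf pF).
by rewrite ComplexField.Normc.normc0.
Qed.

Lemma has_sum_single c p u :
  has_sum (fun q => (if q == p then c else 0) * chi q u) (monomial_fun c p u).
Proof.
have := @has_sum1 R rat (fun q => (if q == p then c else 0) * chi q u) p.
rewrite eqxx; apply => q /negPf->; exact: mul0r.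
Qed.

Lemma monomial_wiener c p : monomial_fun c p \in wiener.
Proof.
apply/wienerP; exists (fun q => if q == p then c else 0); split.
  exact: mass_le_summable (mass_le_single c p).
exact: has_sum_single.
Qed.

Definition monomial c p : wienerQ R := WienerQ (monomial_wiener c p).

Lemma wnorm_le_monomial c p : wnorm_le (monomial c p) (normc c).
Proof.
exists (fun q => if q == p then c else 0); first exact: mass_le_single.
exact: has_sum_single.
Qed.

Lemma monomialM c d p q :
  monomial c p * monomial d q = monomial (c * d) (p + q).
Proof.
apply: wienerQ_eq => u; rewrite /= /monomial_fun chiD.
by rewrite mulrACA.
Qed.

Definition wconst (c : R[i]) := monomial c 0.

Lemma wconstE c u : wconst c u = c.
Proof. by rewrite /= /monomial_fun chi0 mulr1. Qed.

Lemma wconst_is_zmod_morphism : zmod_morphism wconst.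
Proof.
move=> c d; apply: wienerQ_eq => u.
by rewrite [RHS](_ : _ = wconst c u - wconst d u)// !wconstE.
Qed.

Lemma wconst_is_monoid_morphism : monoid_morphism wconst.
Proof.
split=> [|c d]; last by rewrite monomialM addr0.
by apply: wienerQ_eq => u; rewrite wconstE.
Qed.
HB.instance Definition _ :=
  GRing.isZmodMorphism.Build R[i] (wienerQ R) wconst wconst_is_zmod_morphism.
HB.instance Definition _ :=
  GRing.isMonoidMorphism.Build R[i] (wienerQ R) wconst wconst_is_monoid_morphism.

Lemma wnorm_le_const c : wnorm_le (wconst c) (normc c).
Proof. exact: wnorm_le_monomial. Qed.

Lemma wnorm_le1 : wnorm_le 1 1.
Proof.
rewrite -(rmorph1 wconst) -[X in wnorm_le _ X]ComplexField.Normc.normc1.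
exact: wnorm_le_const.
Qed.

Lemma wnorm_le0 : wnorm_le 0 0.
Proof.
rewrite -(rmorph0 wconst) -[X in wnorm_le _ X]ComplexField.Normc.normc0.
exact: wnorm_le_const.
Qed.

Lemma wnorm_leX f c n : wnorm_le f c -> wnorm_le (f ^+ n) (c ^+ n).
Proof.
move=> hf; elim: n => [|n IH]; first exact: wnorm_le1.
by rewrite !exprS; exact: wnorm_leM.
Qed.

Lemma wnorm_le_sum (I : Type) (r : seq I) (x : I -> wienerQ R) c :
  (forall i, wnorm_le (x i) c) -> wnorm_le (\sum_(i <- r) x i) (c *+ size r).
Proof.
move=> h; elim: r => [|i r IH]; first by rewrite big_nil; exact: wnorm_le0.
by rewrite big_cons mulrS; exact: wnorm_leD (h i) IH.
Qed.

Lemma wienerQ_evalM f g u : (f * g) u = f u * g u.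
Proof. by []. Qed.

Lemma wienerQ_evalX f n u : (f ^+ n) u = f u ^+ n.
Proof. by elim: n => [//|n IH]; rewrite !exprS wienerQ_evalM IH. Qed.

(** Neumann series. Expanding each f^n and summing over n first gives
    coefficients of the inverse, of mass at most 1 + c + c^2 + ...; summing over
    the frequencies first identifies the function as the pointwise inverse.
    This is where completeness of the algebra enters. *)
Lemma wnorm_le_neumann f c : wnorm_le f c -> c < 1 ->
  exists2 g, (1 - f) * g = 1 & wnorm_le g (1 - c)^-1.
Proof.
move=> hf c1; have c0 := wnorm_le_ge0 hf.
have /choice[a ha] : forall n, exists a : rat -> R[i], mass_le a (c ^+ n) /\
    forall u, has_sum (fun q => a q * chi q u) ((f ^+ n) u).
  by move=> n; have [a ? ?] := wnorm_leX n hf; exists a.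
pose x (k : rat * nat) := a k.2 k.1.
have hx : mass_le x (1 - c)^-1.
  by apply: mass_le_geometric => // n; have [] := ha n.
have /choice[b hb] : forall q, exists s, has_sum (fun n => x (q, n)) s.
  move=> q; apply: has_sum_ex; apply: abs_summable_fibre1.
  exact: mass_le_summable hx.
have hb1 : mass_le b (1 - c)^-1 by exact: mass_le_fibre hx hb.
pose g u := (1 - f u)^-1.
have hg u : has_sum (fun q => b q * chi q u) (g u).
  pose y (k : rat * nat) := x k * chi k.1 u.
  have hy : mass_le y (1 - c)^-1.
    by apply: mass_le_geometric => // n; apply: mass_le_chi; have [] := ha n.
  have [S hS] := has_sum_ex (mass_le_summable hy).
  have -> : g u = S.
    have fu : normc (f u) < 1 by exact: le_lt_trans (wnorm_le_normc u hf) c1.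
    apply: has_sum_unique (has_sum_geometric fu) _.
    pose sw (k : nat * rat) := (k.2, k.1); pose sw' (k : rat * nat) := (k.2, k.1).
    have s1 : cancel sw sw' by case.
    have s2 : cancel sw' sw by case.
    apply: has_sum_fibre (has_sum_reindex s1 s2 hS) _ => n.
    by rewrite -wienerQ_evalX; exact: (ha n).2.
  apply: (has_sum_fibre hS) => q; have := has_sumZ (chi q u) (hb q).
  rewrite mulrC; congr has_sum; apply/funext => n.
  by rewrite /y mulrC.
have gW : g \in wiener.
  by apply/wienerP; exists b; split=> //; exact: mass_le_summable hb1.
exists (WienerQ gW); last by exists b.
apply: wienerQ_eq => u; rewrite wienerQ_evalM /g /=; apply: divff.
rewrite subr_eq0; apply: contraTneq c1 => fu1.
have := wnorm_le_normc u hf; rewrite -fu1 ComplexField.Normc.normc1.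
by rewrite -leNgt.
Qed.

(** Trigonometric polynomials are dense: truncate the expansion of f. *)
Lemma wnorm_le_trig_approx f e : 0 < e -> exists (F : {fset rat}) (a : rat -> R[i]),
  wnorm_le (f - \sum_(q <- F) monomial (a q) q) e.
Proof.
move=> e0; have [c [a ha hf]] := wnorm_le_ex f.
have [F hF] := mass_tail ha e0; exists F, a.
exists (fun q => if q \in F then 0 else a q); first exact: hF.
move=> u.
have h : has_sum (fun q => \sum_(p <- F) (if q == p then a p else 0) * chi q u)
           (\sum_(p <- F) monomial_fun (a p) p u).
  by apply: has_sum_sum => p; exact: has_sum_single.
have := has_sumB (hf u) h; congr has_sum.
  apply/funext => q; case: ifP => [qF|/negbT qF].
    rewrite (big_fsetD1 q qF) eqxx/= big_seq big1 ?addr0 ?subrr ?mul0r//.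
    by move=> p; rewrite !inE eq_sym => /andP[/negPf-> _]; rewrite mul0r.
  rewrite big_seq big1 ?subr0// => p pF; case: eqP => [qp|]; last by rewrite mul0r.
  by rewrite qp pF in qF.
congr (_ - _); rewrite raddf_sum/=.
by elim/big_rec2: _ => [//|p x y _ ->].
Qed.

End WienerGauge.

(** * Maximal ideals *)

Section ProperIdeals.
Context {A : comNzRingType}.
Implicit Types I : set A.

Definition is_proper_ideal I := [/\ I 0, forall x y, I x -> I y -> I (x + y),
  forall a x, I x -> I (a * x) & ~ I 1].

Lemma proper_idealN I x : is_proper_ideal I -> I x -> I (- x).
Proof. by case=> _ _ IM _ Ix; rewrite -mulN1r; exact: IM. Qed.

Lemma proper_idealB I x y : is_proper_ideal I -> I x -> I y -> I (x - y).
Proof. by move=> hI Ix /(proper_idealN hI); case: hI => _ ID _ _; exact: ID. Qed.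

Lemma proper_ideal_sum I (T : Type) (r : seq T) (x : T -> A) :
  is_proper_ideal I -> (forall i, I (x i)) -> I (\sum_(i <- r) x i).
Proof.
case=> I0 ID _ _ h; elim: r => [|i r IH]; first by rewrite big_nil.
by rewrite big_cons; exact: ID.
Qed.

(** Maximality is stated in the form in which it is used: modulo I, every
    element outside I is invertible. *)
Lemma exists_maximal_ideal (f : A) : (forall g, f * g <> 1) ->
  exists I, [/\ is_proper_ideal I, I f &
    forall y, ~ I y -> exists a, I (1 - a * y)].
Proof.
move=> hf.
(* The empty set is admitted because the union of the empty chain is empty; a
   maximal element is nonempty, the ideal generated by f being larger. *)
pose P : set (set A) := fun I => I = set0 \/ (is_proper_ideal I /\ I f).
have [C CP Ctot|I [PI maxI]] := @Zorn_bigcup A P.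
  case: (pselect (exists2 I, C I & I !=set0)%classic) => [[I CI [x Ix]]|C0]; last first.
    left; apply/seteqP; split=> [x [I CI Ix]|//].
    by apply: C0; exists I => //; exists x.
  have hC J y : C J -> J y -> is_proper_ideal J /\ J f.
    by move=> CJ Jy; case: (CP _ CJ) => // J0; rewrite J0 in Jy.
  have [[I0 _ _ _] If] := hC _ _ CI Ix.
  right; split; last by exists I.
  split.
  - by exists I.
  - move=> y z [J CJ Jy] [K CK Kz]; have [JK|KJ] := Ctot _ _ CJ CK.
      by exists K => //; have [[_ KD _ _] _] := hC _ _ CK Kz; exact: KD (JK _ Jy) Kz.
    by exists J => //; have [[_ JD _ _] _] := hC _ _ CJ Jy; exact: JD Jy (KJ _ Kz).
  - move=> a y [J CJ Jy]; exists J => //.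
    by have [[_ _ JM _] _] := hC _ _ CJ Jy; exact: JM.
  - move=> [J CJ J1]; by have [[_ _ _ +] _] := hC _ _ CJ J1.
have [hI If] : is_proper_ideal I /\ I f.
  case: PI => // I0; exfalso; apply: (maxI (fun y => exists g, y = f * g)).
    split; first by rewrite I0.
    by move=> /(_ 0); rewrite I0; apply; exists 0; rewrite mulr0.
  right; split; last by exists 1; rewrite mulr1.
  split.
  - by exists 0; rewrite mulr0.
  - by move=> _ _ [g ->] [h ->]; exists (g + h); rewrite mulrDr.
  - by move=> a _ [g ->]; exists (a * g); rewrite mulrCA.
  - by move=> [g /esym]; exact: hf.
exists I; split=> // y Iy; apply: contrapT => ny.
have [I0 ID IM I1] := hI.
apply: (maxI (fun z => exists a, I (z - a * y))).
  split.
    by move=> z Iz; exists 0; rewrite mul0r subr0.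
  by move=> /(_ y) h; apply: Iy; apply: h; exists 1; rewrite mul1r subrr.
right; split; last by exists 0; rewrite mul0r subr0.
split.
- by exists 0; rewrite mul0r subr0.
- move=> z w [a Ia] [b Ib]; exists (a + b).
  have -> : z + w - (a + b) * y = (z - a * y) + (w - b * y) by ring.
  exact: ID.
- move=> b z [a Ia]; exists (b * a).
  by rewrite -mulrA -mulrBr; exact: IM.
- by move=> [a Ia]; apply: ny; exists a.
Qed.

End ProperIdeals.

(** * Resolvents modulo an ideal *)

Section Resolvent.
Context {R : realType}.
Implicit Types (f g x : wienerQ R) (I : set (wienerQ R)).

(** Proper ideals stay at distance at least 1 from the constant 1, because
    1 - z is a unit when z has norm less than 1. *)
Lemma proper_ideal_dist1 I z c :
  is_proper_ideal I -> I (1 - z) -> wnorm_le z c -> 1 <= c.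
Proof.
move=> [_ _ IM I1] Iz hz; rewrite leNgt; apply/negP => c1.
have [g hg _] := wnorm_le_neumann hz c1; apply: I1.
by rewrite -hg mulrC; exact: IM.
Qed.

(** Invertibility of 1 - l x modulo I is an open condition in l, with control of
    the inverse: b' is b times the Neumann series of d = (m - l) x b. *)
Lemma resolvent_near I x b (B : R) (l m : R[i]) : is_proper_ideal I ->
  wnorm_le x 1 -> wnorm_le b B -> I (1 - b * (1 - wconst l * x)) ->
  normc (m - l) * B <= 1 / 2 ->
  exists2 b', wnorm_le b' (2 * B) & I (1 - b' * (1 - wconst m * x)).
Proof.
move=> [_ _ IM _] hx hb Ib ml; pose d := wconst (m - l) * x * b.
have hd : wnorm_le d (1 / 2).
  apply: wnorm_le_mono ml _; rewrite -[X in X * B]mulr1.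
  exact: wnorm_leM (wnorm_leM (wnorm_le_const _) hx) hb.
have [g hg wg] := wnorm_le_neumann hd ltac:(by lra).
exists (b * g).
  rewrite mulrC (_ : 2 = (1 - 1 / 2)^-1); last by field.
  exact: wnorm_leM wg hb.
have -> : 1 - b * g * (1 - wconst m * x) = g * (1 - b * (1 - wconst l * x)).
  by rewrite -[X in X - _]hg /d rmorphB/=; ring.
exact: IM.
Qed.

Lemma normc_le_add (a b c : R) : `|a| < c -> `|b| < c -> normc (a +i* b)%C <= 2 * c.
Proof. by move=> ha hb; case: (normc_le (a +i* b)%C) => _ _ /=; lra. Qed.

(** Uniform bound on the inverses, from the local one and the compactness of a
    square containing the disc of radius 2. *)
Lemma resolvent_bounded I x : is_proper_ideal I -> wnorm_le x 1 ->
  (forall l : R[i], exists b, I (1 - b * (1 - wconst l * x))) ->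
  exists B : R, forall l : R[i], normc l <= 2 ->
    exists2 b, wnorm_le b B & I (1 - b * (1 - wconst l * x)).
Proof.
move=> hI hx hinv.
pose K := (`[(-2 : R), 2] `*` `[(-2 : R), 2])%classic.
have cK : compact K by apply: compact_setX; exact: segment_compact.
pose P (n : nat) (p : R * R) :=
  exists2 b, wnorm_le b n%:R & I (1 - b * (1 - wconst (p.1 +i* p.2)%C * x)).
have := (compact_near_coveringP K).1 cK nat (\oo)%classic P _.
case=> [p _|n _ hn]; last first.
  exists n%:R => -[a b] hl.
  have [h1 h2 _] := normc_le (a +i* b)%C.
  apply: (hn n (leqnn _) (a, b)); split; rewrite /= in_itv/= -ler_norml.
    exact: le_trans h1 hl.
  exact: le_trans h2 hl.
have [b Ib] := hinv (p.1 +i* p.2)%C.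
have [B0 hB0] := wnorm_le_ex b; have B0_ge0 := wnorm_le_ge0 hB0.
pose B := B0 + 1; have B_gt0 : 0 < B by rewrite /B; lra.
have {hB0} hB : wnorm_le b B by apply: wnorm_le_mono hB0; rewrite /B; lra.
pose e := (4 * B)^-1; have e0 : 0 < e by rewrite invr_gt0; lra.
have [n0 hn0] : exists n0 : nat, 2 * B <= n0%:R.
  by exists (Num.trunc (2 * B)).+1; apply: ltW; exact: truncnS_gt.
(* On the ball of radius e around p one has |m - l| <= 2 e = 1 / (2 B). *)
exists (ball p e, [set n | (n0 <= n)%N])%classic => /=.
  by split; [exact: nbhsx_ballx|exists n0].
move=> [q n] /= [[hq1 hq2] hn].
have [|b' wb' Ib'] :=
    @resolvent_near I x b B (p.1 +i* p.2)%C (q.1 +i* q.2)%C hI hx hB Ib.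
  have -> : (q.1 +i* q.2 - (p.1 +i* p.2))%C = ((q.1 - p.1) +i* (q.2 - p.2))%C by [].
  have -> : 1 / 2 = 2 * e * B by rewrite /e; field; rewrite gt_eqF.
  by rewrite ler_pM2r//; apply: normc_le_add; rewrite distrC.
exists b'; last exact: Ib'.
by apply: wnorm_le_mono wb'; apply: le_trans hn0 _; rewrite ler_nat.
Qed.

(** The resolvent identity; it makes a bounded resolvent Lipschitz. *)
Lemma resolvent_diff I x (b b' : wienerQ R) (l m : R[i]) : is_proper_ideal I ->
  I (1 - b * (1 - wconst l * x)) -> I (1 - b' * (1 - wconst m * x)) ->
  I (b - b' - wconst (l - m) * x * b * b').
Proof.
move=> hI Ib Ib'; have [_ _ IM _] := hI.
have -> : b - b' - wconst (l - m) * x * b * b' =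
  b * (1 - b' * (1 - wconst m * x)) - b' * (1 - b * (1 - wconst l * x)).
  by rewrite rmorphB/=; ring.
by apply: proper_idealB => //; exact: IM.
Qed.

Lemma sum_unity_root_exp (w : R[i]) (M j : nat) : M.-primitive_root w ->
  (0 < j < M)%N -> \sum_(i < M) (w ^+ i) ^+ j = 0.
Proof.
move=> hw /andP[j0 jM].
have wj : w ^+ j - 1 != 0.
  rewrite subr_eq0 -(prim_order_dvd hw); apply: contraL jM => /dvdn_leq.
  by rewrite -leqNgt; apply.
apply: (mulfI wj); rewrite mulr0 (eq_bigr (fun i : 'I_M => (w ^+ j) ^+ i)).
  by rewrite -subrX1 exprAC (prim_expr_order hw) expr1n subrr.
by move=> i _; rewrite exprAC.
Qed.

Lemma exists_primitive_root (M : nat) : (0 < M)%N ->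
  exists w : R[i], M.-primitive_root w.
Proof.
move=> M0; have [r hr] := closed_field_poly_normal ('X^M - 1 : {poly R[i]}).
have lc : lead_coef ('X^M - 1 : {poly R[i]}) = 1.
  by apply/eqP; rewrite -[_ == _]/(_ \is monic) monicXnsubC.
rewrite lc scale1r in hr.
have sz : size r = M.
  by apply: succn_inj; rewrite -(size_prod_XsubC r id) -hr size_XnsubC.
have : has M.-primitive_root r; last by case/hasP => w _ hw; exists w.
apply: has_prim_root => //; last by rewrite sz.
- apply/allP => z zr; rewrite unity_rootE -subr_eq0.
  have : root ('X^M - 1) z by rewrite hr root_prod_XsubC.
  by rewrite rootE !hornerE.
- by rewrite -separable_prod_XsubC -hr separable_Xn_sub_1// pnatr_eq0 -lt0n.
Qed.

Lemma normc_unity_root (w : R[i]) M i : M.-primitive_root w -> normc (w ^+ i) = 1.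
Proof.
move=> hw; have M0 := prim_order_gt0 hw.
have h : normc w ^+ M = 1.
  by rewrite -normcX (prim_expr_order hw) ComplexField.Normc.normc1.
rewrite normcX; suff -> : normc w = 1 by rewrite expr1n.
by apply/eqP; rewrite -(pexpr_eq1 M0 (normc_ge0 w)) h.
Qed.

(** The average over the M-th roots of unity w^i of 1/(1 - r w^i x) is
    1/(1 - (r x)^M), modulo I. Indeed
    (1 - (r x)^M)/(1 - r w^i x) is the sum of the (r w^i x)^j for j < M, and
    averaging over i keeps only the term j = 0. *)
Lemma resolvent_average I x (F : R[i] -> wienerQ R) (w : R[i]) M (r : R[i]) :
  is_proper_ideal I -> M.-primitive_root w ->
  (forall i : 'I_M, I (1 - F (r * w ^+ i) * (1 - wconst (r * w ^+ i) * x))) ->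
  I ((1 - (wconst r * x) ^+ M) *
     (wconst (M%:R^-1) * \sum_(i < M) F (r * w ^+ i)) - 1).
Proof.
move=> hI hw hF; have [_ _ IM _] := hI; have M0 := prim_order_gt0 hw.
pose y i := wconst (r * w ^+ i) * x.
have yM i : y i ^+ M = (wconst r * x) ^+ M.
  rewrite /y rmorphM -mulrA mulrCA exprMn -rmorphXn/= exprAC.
  by rewrite (prim_expr_order hw) expr1n rmorph1 mul1r.
have Mn0 : M%:R != 0 :> R[i] by rewrite pnatr_eq0 -lt0n.
have hS : \sum_(i < M) \sum_(j < M) y i ^+ j = wconst M%:R.
  rewrite exchange_big/= (bigD1 (Ordinal M0))//= [X in _ + X]big1 ?addr0.
    by under eq_bigr do rewrite expr0; rewrite sumr_const card_ord rmorph_nat.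
  move=> j j0; pose c := (wconst r * x) ^+ j.
  rewrite (eq_bigr (fun i : 'I_M => wconst ((w ^+ i) ^+ j) * c)); last first.
    by move=> i _; rewrite /c /y rmorphM -mulrA mulrCA exprMn -rmorphXn.
  rewrite -mulr_suml -raddf_sum/= (sum_unity_root_exp hw) ?raddf0 ?mul0r//.
  by rewrite ltn_ord andbT lt0n.
have -> : (1 - (wconst r * x) ^+ M) *
     (wconst (M%:R^-1) * \sum_(i < M) F (r * w ^+ i)) - 1 =
  - (wconst (M%:R^-1) * \sum_(i < M) ((\sum_(j < M) y i ^+ j) *
      (1 - F (r * w ^+ i) * (1 - y i)))).
  have h1 : 1 = wconst M%:R^-1 * \sum_(i < M) \sum_(j < M) y i ^+ j :> wienerQ R.
    by rewrite hS -rmorphM mulVf// rmorph1.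
  rewrite [X in _ - X]h1 mulrCA -mulrBr -mulrN; congr (_ * _).
  rewrite mulr_sumr -sumrB -sumrN; apply: eq_bigr => i _.
  have := subrX1 (y i) M; rewrite yM => h.
  have -> : 1 - (wconst r * x) ^+ M = (1 - y i) * \sum_(j < M) y i ^+ j.
    by rewrite -opprB h -mulNr opprB.
  by ring.
apply: proper_idealN => //; apply: (IM); apply: proper_ideal_sum => // i.
by apply: IM; exact: hF.
Qed.

End Resolvent.

(** * Existence of spectral values *)

Section Spectrum.
Context {R : realType}.
Implicit Types (f g x y : wienerQ R) (I : set (wienerQ R)).

Lemma wnorm_le_average (M : nat) (x : 'I_M -> wienerQ R) c : (0 < M)%N ->
  (forall i, wnorm_le (x i) c) -> wnorm_le (wconst M%:R^-1 * \sum_(i < M) x i) c.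
Proof.
move=> M0 hx; have := wnorm_le_sum (index_enum 'I_M) hx.
rewrite -[size _]/(size (index_enum 'I_M)) /index_enum -enumT size_enum_ord => h.
have -> : c = normc (M%:R^-1 : R[i]) * (c *+ M).
  have -> : M%:R^-1 = (M%:R^-1)%:C%C :> R[i].
    by rewrite fmorphV rmorph_nat.
  rewrite normc_real ?invr_ge0// -[c *+ M]mulr_natl mulKf// pnatr_eq0 -lt0n//.
exact: wnorm_leM (wnorm_le_const _) h.
Qed.

(** If x - l were invertible modulo I for every l, the averages G r and G (1/r)
    of the resolvent over the circles of radii r < 1 and 1/r would satisfy,
    modulo I and for large M: 1 - G r and G (1/r) are close to 0, and
    G r - G (1/r) has norm at most (1/r - r) B^2. Adding up, 1 would be at
    distance less than 1 from I. *)
Lemma exists_spectral_value I x y : is_proper_ideal I -> x * y = 1 ->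
  wnorm_le x 1 -> wnorm_le y 1 ->
  exists l : R[i], forall a, ~ I (1 - a * (x - wconst l)).
Proof.
move=> hI xy wx wy; apply: contrapT => hnone.
have hinv (l : R[i]) : exists b, I (1 - b * (1 - wconst l * x)).
  have [->|l0] := eqVneq l 0.
    by exists 1; rewrite raddf0 mul0r subr0 mulr1 subrr; case: hI.
  have [a Ia] : exists a, I (1 - a * (x - wconst l^-1)).
    apply: contrapT => na; apply: hnone; exists l^-1 => a Ia; apply: na.
    by exists a.
  (* 1 - l x = - l (x - 1/l) *)
  exists (- (wconst l^-1 * a)).
  have -> // : 1 - - (wconst l^-1 * a) * (1 - wconst l * x) =
    1 - a * (x - wconst l^-1).
  have e : wconst l^-1 * wconst l = 1 by rewrite -rmorphM mulVf ?rmorph1.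
  have -> : 1 - - (wconst l^-1 * a) * (1 - wconst l * x) =
    1 - a * ((wconst l^-1 * wconst l) * x - wconst l^-1) by ring.
  by rewrite e mul1r.
have [B0 hB0] := resolvent_bounded hI wx hinv.
pose B := B0 + 1.
have hB l : exists b, normc l <= 2 -> wnorm_le b B /\ I (1 - b * (1 - wconst l * x)).
  have [l2|l2] := boolP (normc l <= 2); last by exists 0.
  have [b wb Ib] := hB0 l l2; exists b => _; split; last exact: Ib.
  by apply: wnorm_le_mono wb; rewrite /B; lra.
have [F hF] := choice hB.
have B1 : 1 <= B.
  have [|b wb _] := hB0 0; first by rewrite ComplexField.Normc.normc0.
  by have := wnorm_le_ge0 wb; rewrite /B; lra.
(* With r = 1 - d, 1/r - r <= 4 d, so this d gives (1/r - r) B^2 <= 1/3. *)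
pose d := (12 * B ^+ 2)^-1.
have d0 : 0 < d by rewrite invr_gt0; nra.
have dB : d * B ^+ 2 = 1 / 12 by rewrite /d; field; rewrite gt_eqF//; lra.
have d1 : d <= 1 / 12 by rewrite -dB ler_peMr ?exprn_ege1// ltW.
pose r := 1 - d; have r0 : 0 < r by rewrite /r; lra.
have r1 : r < 1 by rewrite /r; lra.
have rV : r^-1 - r <= 4 * d.
  rewrite -(ler_pM2r r0) mulrBl mulVf ?gt_eqF// /r; nra.
have rV1 : r <= r^-1 by apply: le_trans (ltW r1) _; rewrite invf_ge1// ltW.
have rV2 : r^-1 <= 2 by rewrite /r in rV *; lra.
have B6 : 0 < (6 * B)^-1 by rewrite invr_gt0; lra.
have [M0 hM0] := exprn_lt_eps (ltW r0) r1 B6.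
(* Hence r^M (2 B + 1) <= 3 r^M B < 1/2, and 1/2 + 1/3 < 1. *)
pose M := M0.+1; have hM : r ^+ M < (6 * B)^-1 by apply: hM0.
have [w hw] : exists w : R[i], M.-primitive_root w by exact: exists_primitive_root.
have nF (s : R) i : 0 <= s -> s <= 2 ->
    wnorm_le (F (s%:C%C * w ^+ i)) B /\
    I (1 - F (s%:C%C * w ^+ i) * (1 - wconst (s%:C%C * w ^+ i) * x)).
  move=> s0 s2; apply: (hF (s%:C%C * w ^+ i)).
  by rewrite normcM (normc_unity_root i hw) mulr1 normc_real.
pose G (s : R) := wconst (M%:R^-1) * \sum_(i < M) F (s%:C%C * w ^+ i).
have r2 : r <= 2 by lra.
have rV0 : 0 <= r^-1 by rewrite invr_ge0 ltW.
have A1 := resolvent_average hI hw (fun i => (nF r i (ltW r0) r2).2).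
have A2 := resolvent_average hI hw (fun i => (nF r^-1 i rV0 rV2).2).
rewrite -/(G r) in A1; rewrite -/(G r^-1) in A2.
have wG s : 0 <= s -> s <= 2 -> wnorm_le (G s) B.
  by move=> s0 s2; apply: wnorm_le_average => [//|i]; have [] := nF s i s0 s2.
(* D is what the resolvent identity gives for G r - G (1/r) modulo I. *)
pose D := wconst (M%:R^-1) * \sum_(i < M)
   (wconst (r%:C%C * w ^+ i - (r^-1)%:C%C * w ^+ i) * x *
    F (r%:C%C * w ^+ i) * F ((r^-1)%:C%C * w ^+ i)).
have wD : wnorm_le D (1 / 3).
  apply: wnorm_le_average => [//|i].
  have [w1 _] := nF r i (ltW r0) r2; have [w2 _] := nF r^-1 i rV0 rV2.
  have h := wnorm_leM (wnorm_leM (wnorm_leM (wnorm_le_const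
     (r%:C%C * w ^+ i - (r^-1)%:C%C * w ^+ i)) wx) w1) w2.
  apply: wnorm_le_mono h; rewrite -mulrBl normcM (normc_unity_root i hw).
  have -> : r%:C%C - (r^-1)%:C%C = - (r^-1 - r)%:C%C :> R[i].
    by rewrite -opprB; congr (- _); rewrite [RHS]rmorphB.
  rewrite normcN normc_real ?subr_ge0// !mulr1 -mulrA -expr2.
  have := ler_wpM2r (sqr_ge0 B) rV; lra.
have AD : I (G r - G r^-1 - D).
  rewrite /G /D -!mulrBr -!sumrB; case: (hI) => _ _ IM _; apply: IM.
  apply: (proper_ideal_sum _ hI) => i.
  exact: resolvent_diff hI (nF r i (ltW r0) r2).2 (nF r^-1 i rV0 rV2).2.
(* v is the inverse of the M-th power of x / r; it is small, like u below. *)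
pose v := (wconst r%:C%C * y) ^+ M.
have vE : v * (wconst (r^-1)%:C%C * x) ^+ M = 1.
  rewrite /v -exprMn mulrACA -rmorphM [y * x]mulrC xy mulr1.
  by rewrite -rmorphM/= mulfV ?gt_eqF// !rmorph1 expr1n.
have wv : wnorm_le v (r ^+ M).
  apply: wnorm_leX; rewrite -[X in wnorm_le _ X]mulr1; apply: wnorm_leM wy.
  by rewrite -{2}(normc_real (ltW r0)); exact: wnorm_le_const.
pose u := (wconst r%:C%C * x) ^+ M.
have wu : wnorm_le u (r ^+ M).
  apply: wnorm_leX; rewrite -[X in wnorm_le _ X]mulr1; apply: wnorm_leM wx.
  by rewrite -{2}(normc_real (ltW r0)); exact: wnorm_le_const.
(* 1 = (1 - G r) + (G r - G (1/r)) + G (1/r), where modulo I the first term is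
   - u G r, the second is D, and the third is v (G (1/r) - 1). *)
pose z := - (u * G r) + D + (v * G r^-1 - v).
have wz : wnorm_le z (r ^+ M * B + 1 / 3 + (r ^+ M * B + r ^+ M)).
  have W1 := wG r (ltW r0) r2; have W2 := wG r^-1 rV0 rV2.
  apply: wnorm_leD (wnorm_leB (wnorm_leM wv W2) wv).
  exact: wnorm_leD (wnorm_leN (wnorm_leM wu W1)) wD.
have Iz : I (1 - z).
  have -> : 1 - z = - ((1 - u) * G r - 1) + (G r - G r^-1 - D) -
      v * ((1 - (wconst (r^-1)%:C%C * x) ^+ M) * G r^-1 - 1).
    rewrite /z; set y' := (wconst _ * x) ^+ M.
    transitivity (1 + u * G r - D - v * G r^-1 + v
       + (v * y') * G r^-1 - G r^-1); last by ring.
    by rewrite vE; ring.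
  case: (hI) => _ ID IM _.
  exact: proper_idealB hI (ID _ _ (proper_idealN hI A1) AD) (IM _ _ A2).
have := proper_ideal_dist1 hI Iz wz.
have Bgt0 : 0 < B by lra.
have h6 : r ^+ M * B < 1 / 6.
  have -> : 1 / 6 = (6 * B)^-1 * B by field; rewrite gt_eqF.
  by rewrite ltr_pM2r.
have h0 : r ^+ M <= r ^+ M * B by rewrite ler_peMr// exprn_ge0// ltW.
by lra.
Qed.

End Spectrum.

(** * The point of the solenoid defined by an ideal *)

Section PointOfIdeal.
Context {R : realType} {I : set (wienerQ R)} (hI : is_proper_ideal I).

Lemma ideal_const0 (c : R[i]) : I (wconst c) -> c = 0.
Proof.
move=> Ic; apply/eqP; apply: contrapT => /negP c0; case: hI => _ _ IM; apply.
by rewrite -(rmorph1 wconst) -(mulVf c0) rmorphM; exact: IM.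
Qed.

(** Both chi_q and its inverse chi_(-q) have norm 1. If |l| < 1 then
    chi_q - l is chi_q times 1 - l chi_(-q), and if |l| > 1 it is - l times
    1 - chi_q / l; either way it is a unit. *)
Lemma spectral_value_norm (q : rat) (l : R[i]) :
  I (monomial 1 q - wconst l) -> normc l = 1.
Proof.
move=> Il; have [_ _ IM I1] := hI; apply/eqP; rewrite eq_le; apply/andP; split.
  have [->|l0] := eqVneq l 0; first by rewrite ComplexField.Normc.normc0 ler01.
  have h : I (1 - wconst l^-1 * monomial 1 q).
    have := IM (- wconst l^-1) _ Il; rewrite mulrBr !mulNr opprK addrC.
    by rewrite -rmorphM mulVf// rmorph1.
  have w := wnorm_leM (wnorm_le_const l^-1) (wnorm_le_monomial 1 q).
  have := proper_ideal_dist1 hI h w.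
  rewrite ComplexField.Normc.normc1 mulr1 normcV// => h1.
  by rewrite -(invf_ge1 (normc_gt0 l0)).
have h : I (1 - wconst l * monomial 1 (- q)).
  have := IM (monomial 1 (- q)) _ Il.
  rewrite mulrBr monomialM addNr mulr1 [monomial _ _ * wconst _]mulrC.
  by rewrite (_ : monomial 1 0 = 1)// -(rmorph1 wconst).
have w := wnorm_leM (wnorm_le_const l) (wnorm_le_monomial 1 (- q)).
by have := proper_ideal_dist1 hI h w; rewrite ComplexField.Normc.normc1 mulr1.
Qed.

Context {L : rat -> R[i]} (hL : forall q, I (monomial 1 q - wconst (L q))).

Lemma spectral_value_unique q l : I (monomial 1 q - wconst l) -> l = L q.
Proof.
move=> Il; apply/eqP; rewrite -subr_eq0; apply/eqP; apply: ideal_const0.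
rewrite rmorphB/=.
have -> : wconst l - wconst (L q) =
  (monomial 1 q - wconst (L q)) - (monomial 1 q - wconst l) by ring.
exact: proper_idealB hI (hL q) Il.
Qed.

Lemma spectral_valueD p q : L (p + q) = L p * L q.
Proof.
apply/esym/spectral_value_unique; have [_ ID IM _] := hI.
rewrite -[X in monomial X _](mulr1 1) -monomialM rmorphM/=.
have -> : monomial 1 p * monomial 1 q - wconst (L p) * wconst (L q) =
  monomial 1 q * (monomial 1 p - wconst (L p)) +
  wconst (L p) * (monomial 1 q - wconst (L q)) by ring.
by apply: (ID); apply: (IM).
Qed.

Lemma spectral_value0 : L 0 = 1.
Proof.
apply/esym/spectral_value_unique.
by rewrite rmorph1 -(rmorph1 wconst) subrr; case: hI.
Qed.

Lemma spectral_valueMn p n : L (p *+ n) = L p ^+ n.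
Proof.
elim: n => [|n IH]; first by rewrite mulr0n expr0 spectral_value0.
by rewrite mulrS spectral_valueD IH exprS.
Qed.

Lemma spectral_value_neq0 p : L p != 0.
Proof.
apply/eqP => h; have := spectral_value_norm (hL p).
by rewrite h ComplexField.Normc.normc0 => /eqP; rewrite eq_sym oner_eq0.
Qed.

Lemma spectral_valueMz p (k : int) : L (p *~ k) = L p ^ k.
Proof.
case: k => n; first exact: spectral_valueMn.
rewrite NegzE mulrNz -exprnN -pmulrn -spectral_valueMn.
apply: (mulfI (spectral_value_neq0 (p *+ n.+1))).
by rewrite -spectral_valueD subrr spectral_value0 mulfV// spectral_value_neq0.
Qed.

Lemma ideal_point_circle (N : posnat) : `|L (val N)%:R^-1| = 1.
Proof. by rewrite norm_normc (spectral_value_norm (hL _)). Qed.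

Lemma ideal_point_compat (m n : posnat) : (val n %| val m)%N ->
  L (val m)%:R^-1 ^+ (val m %/ val n) = L (val n)%:R^-1.
Proof.
move=> nm; rewrite -spectral_valueMn; congr L.
have m0 : (val m)%:R != 0 :> rat by rewrite pnatr_eq0 -lt0n (valP m).
have n0 : (val n)%:R != 0 :> rat by rewrite pnatr_eq0 -lt0n (valP n).
apply: (mulfI m0); rewrite -[_^-1 *+ _]mulr_natr mulrA mulfV// mul1r.
by rewrite -[in RHS](divnK nm) natrM mulfK.
Qed.

(** A homomorphism L from the rationals to the circle is evaluation of the
    characters at the thread of the values L (1/N). *)
Definition ideal_point : solenoid R :=
  Solenoid ideal_point_circle ideal_point_compat.

Lemma chi_ideal_point q : chi q ideal_point = L q.
Proof.
rewrite /chi /= -spectral_valueMz; congr L.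
rewrite -mulrzr -[in RHS](divq_num_den q) mulrC; congr (_ / _).
by rewrite -[in RHS]absz_denq.
Qed.

(** Approximate f by a trigonometric polynomial P. As P - P(u) lies in I, so
    does f - (P - P(u)), which is f(u) up to h - h(u) with h = f - P small. A
    nonzero f(u) would put an element of I near a nonzero constant. *)
Lemma ideal_vanishes f : I f -> f ideal_point = 0.
Proof.
move=> If; have [_ ID IM _] := hI; apply/eqP; apply: contrapT => /negP fu0.
(* h - h(u) has norm at most 2 e, which has to stay below |f(u)|. *)
pose e := normc (f ideal_point) / 3.
have e0 : 0 < e by rewrite divr_gt0// normc_gt0.
have [F [a ha]] := wnorm_le_trig_approx f e0.
pose P := \sum_(q <- F) monomial (a q) q.
pose h := f - P.
have IP : I (P - wconst (P ideal_point)).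
  have -> : wconst (P ideal_point) = \sum_(q <- F) wconst (a q * L q).
    rewrite -raddf_sum; congr wconst; rewrite /P.
    elim/big_rec2: _ => [//|q x y _ <-].
    by rewrite -chi_ideal_point.
  rewrite /P -sumrB; apply: (proper_ideal_sum _ hI) => q.
  have -> : monomial (a q) q = wconst (a q) * monomial 1 q.
    by rewrite monomialM add0r mulr1.
  by rewrite rmorphM -mulrBr; apply: (IM).
pose c := f ideal_point.
have cE : c = h ideal_point + P ideal_point by rewrite /c /h -[f in LHS](subrK P).
pose z := - (wconst c^-1 * (h - wconst (h ideal_point))).
have Iz : I (1 - z).
  have -> : 1 - z = wconst c^-1 * (f - (P - wconst (P ideal_point))).
    have e1 : 1 = wconst c^-1 * (wconst (h ideal_point) + wconst (P ideal_point)).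
      by rewrite -rmorphD -rmorphM -cE mulVf ?rmorph1.
    by rewrite /z [X in X - _]e1 /h; ring.
  by apply: (IM); exact: proper_idealB hI If IP.
have wh := wnorm_leB ha (wnorm_le_const (h ideal_point)).
have wz := wnorm_leN (wnorm_leM (wnorm_le_const c^-1) wh).
have := proper_ideal_dist1 hI Iz wz.
have hp := wnorm_le_normc ideal_point ha.
rewrite normcV// -/c mulrC ler_pdivlMr ?normc_gt0// mul1r.
have : normc c = 3 * e by rewrite /e /c; field.
by rewrite -/(h ideal_point) in hp *; lra.
Qed.

End PointOfIdeal.

(** * Wiener's lemma and matrices *)

Section WienerLemma.
Context {R : realType}.

(** A nonunit lies in a maximal ideal, hence vanishes at its point. *)
Lemma wiener_lemma (f : wienerQ R) : (forall u, f u != 0) -> exists g, f * g = 1.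
Proof.
move=> f0; apply: contrapT => nf.
have [|I [hI If Imax]] := @exists_maximal_ideal _ f.
  by move=> g hg; apply: nf; exists g.
have /choice[L hL] : forall q, exists l, I (monomial 1 q - wconst l).
  move=> q.
  have xy : monomial 1 q * monomial 1 (- q) = 1 :> wienerQ R.
    by rewrite monomialM subrr mulr1 -(rmorph1 wconst).
  have w p : wnorm_le (monomial 1 p : wienerQ R) 1.
    rewrite -[X in wnorm_le _ X](@ComplexField.Normc.normc1 R).
    exact: wnorm_le_monomial.
  have [l hl] := exists_spectral_value hI xy (w q) (w (- q)).
  exists l; apply: contrapT => /Imax[a Ia]; exact: hl a Ia.
by have := f0 (ideal_point hI hL); rewrite (ideal_vanishes hI hL If) eqxx.
Qed.

Definition weval (u : solenoid R) (f : wienerQ R) : R[i] := f u.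

Lemma weval_is_zmod_morphism u : zmod_morphism (weval u).
Proof. by []. Qed.

Lemma weval_is_monoid_morphism u : monoid_morphism (weval u).
Proof. by []. Qed.

HB.instance Definition _ u :=
  GRing.isZmodMorphism.Build (wienerQ R) R[i] (weval u) (weval_is_zmod_morphism u).
HB.instance Definition _ u :=
  GRing.isMonoidMorphism.Build (wienerQ R) R[i] (weval u)
    (weval_is_monoid_morphism u).

Lemma mxevalE n (A : 'M[wienerQ R]_n) u : mxeval A u = map_mx (weval u) A.
Proof. by apply/matrixP => i j; rewrite !mxE. Qed.

End WienerLemma.

Theorem proposition5 (R : realType) (n : nat) (A : 'M[wienerQ R]_n) :
  ((forall x : solenoid R, \det (mxeval A x) != 0) ->
   exists B : 'M[wienerQ R]_n,
     forall x : solenoid R, mxeval B x = invmx (mxeval A x))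
  /\
  ((forall x : solenoid R, mxeval A x \in unitmx) <->
   exists B : 'M[wienerQ R]_n, A *m B = 1%:M /\ B *m A = 1%:M).
Proof.
have inv : (forall x : solenoid R, \det (mxeval A x) != 0) ->
   exists B : 'M[wienerQ R]_n, A *m B = 1%:M /\ B *m A = 1%:M.
  move=> hdet; have [u|g hg] := @wiener_lemma R (\det A).
    by have := hdet u; rewrite mxevalE det_map_mx.
  exists (g *: \adj A); split.
    by rewrite -scalemxAr mul_mx_adj scale_scalar_mx mulrC hg.
  by rewrite -scalemxAl mul_adj_mx scale_scalar_mx mulrC hg.
have evalB (B : 'M[wienerQ R]_n) u : A *m B = 1%:M ->
    mxeval A u *m mxeval B u = 1%:M.
  by move=> AB; rewrite !mxevalE -map_mxM AB map_mx1.
split.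
  move=> /[dup] hdet /inv[B [AB _]]; exists B => u.
  have := evalB B u AB => h; have [Au _] := mulmx1_unit h.
  by rewrite -[LHS]mul1mx -(mulVmx Au) -mulmxA h mulmx1.
split=> [h|[B [AB _]] u]; last by have [] := mulmx1_unit (evalB B u AB).
by apply: inv => u; have := h u; rewrite unitmxE unitfE.
Qed.
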